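(* Let $n\ge 2$. Every number $q_0$ of the form $q_0=-a/b$ with $a\in\{1,2,\dots,n\}$, $b\in\mathbb{N}$ and $b\ge n$ (where $a$ and $b$ are not required to be coprime) is singular.
   Context: Let $\mathbf{x}=x_1,\dots,x_n$ and $\partial_i=\partial/\partial x_i$. For $k\ge 1$ put $\nabla_k=\sum_{i=1}^n\partial_i^k$ and $\widetilde{D}_k=\sum_{i=1}^n x_i\partial_i^{k+1}$, and for $q_0\in\mathbb{C}$ put $D_{k;q_0}=q_0\widetilde{D}_k+\nabla_k$, acting on $\mathbb{C}[\mathbf{x}]$. The space of $q_0$-harmonics is $\mathcal{H}_{\mathbf{x};q_0}=\{f\in\mathbb{C}[\mathbf{x}] : D_{k;q_0}f=0 \text{ for all } k\ge 1\}$. It is graded by polynomial degree and stable under the action of the symmetric group $\mathfrak{S}_n$ permuting the variables. Its (graded) Frobenius characteristic is $F_{n;q_0}(t)=\sum_{d\ge 0}t^d\,\mathrm{Frob}(\pi_d(\mathcal{H}_{\mathbf{x};q_0}))$, where $\pi_d$ denotes the homogeneous component of degree $d$ and $\mathrm{Frob}$ is the usual Frobenius characteristic map from $\mathfrak{S}_n$-representations to symmetric functions (sending the irreducible indexed by $\lambda$ to the Schur function $s_\lambda$). For $q_0=0$ one obtains the classical $\mathfrak{S}_n$-harmonics, with Frobenius characteristic $F_n(t)=F_{n;0}(t)$. A complex number $q_0$ is called singular (for the given $n$) if $F_{n;q_0}(t)\ne F_n(t)$. *)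

(* Defs.v *)
From HB Require Import structures.
From mathcomp Require Import all_boot all_fingroup all_algebra.
From mathcomp Require Import boolp classical_sets reals complex mpoly.

Set Implicit Arguments.
Unset Strict Implicit.
Unset Printing Implicit Defensive.

Import GRing.Theory.
Local Open Scope ring_scope.

(* The subspace {v | P v}; it is the junk value 0 when P does not cut out a
   linear subspace (see vspace_ofP). *)
Definition vspace_of (K : fieldType) (V : vectType K) (P : V -> Prop) :
  {vspace V} := xget 0%VS [set U : {vspace V} | forall v, v \in U <-> P v].

Lemma vspace_ofP (K : fieldType) (V : vectType K) (P : V -> Prop) :
    P 0 -> (forall (c : K) u v, P u -> P v -> P (c *: u + v)) ->
  forall v, v \in vspace_of P <-> P v.
Proof.
move=> P0 Plin; rewrite /vspace_of; case: xgetP => [U _ //|noU].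
have [U [subU maxU]] :
    exists U : {vspace V}, (forall v, v \in U -> P v) /\
      forall W : {vspace V}, (forall v, v \in W -> P v) -> (\dim W <= \dim U)%N.
- pose Q k := `[< exists U : {vspace V},
                    (forall v, v \in U -> P v) /\ \dim U = k >].
  have exQ : exists k, Q k.
    exists 0%N; apply/asboolP; exists 0%VS; split; last exact: dimv0.
    by move=> v; rewrite memv0 => /eqP->.
  have Qbd k : Q k -> (k <= \dim {:V})%N.
    by move=> /asboolP [U [_ <-]]; exact/dimvS/subvf.
  case: (ex_maxnP exQ Qbd) => k /asboolP [U [subU dimU]] maxk.
  exists U; split=> // W subW; rewrite dimU; apply: maxk.
  by apply/asboolP; exists W.
exfalso; apply: (noU U) => /= v; split; first exact: subU.
move=> Pv; have subW w : w \in (<[v]> + U)%VS -> P w.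
  by case/memv_addP=> _ /vlineP [c ->] [u /subU Pu ->]; exact: Plin.
have /eqP -> : U == (<[v]> + U)%VS by rewrite eqEdim addvSr maxU.
by rewrite memvE addvSl.
Qed.

(* Trace of the restriction of f to U, for f linear and stabilizing U. *)
Definition trace_on (K : fieldType) (V : vectType K) (U : {vspace V})
    (f : V -> V) : K :=
  \sum_(i < \dim U) coord (vbasis U) i (f (vbasis U)`_i).

Section Harmonics.
Context (K : fieldType) (n : nat).
Implicit Types (p f g : {mpoly K[n]}) (q : K) (d k : nat) (s : 'S_n).

Definition nabla k p := \sum_(i < n) p^`M(i, k).

Definition Dtilde k p := \sum_(i < n) 'X_i * p^`M(i, k.+1).

Definition Dop q k p := q *: Dtilde k p + nabla k p.

Definition qharmonic q p := forall k, (0 < k)%N -> Dop q k p = 0.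

(* Homogeneous polynomials of degree d. The library makes dhomog a vectType
   only in a successor number of variables, hence this alias. *)
Definition hpoly d : Type := dhomog n K d.
HB.instance Definition _ d := GRing.Lmodule.on (hpoly d).

Let hmonom d : finType := {m : 'X_{1..n < d.+1} | mdeg m == d}.

Lemma hpoly_vecaxiom d : Vector.axiom #|{: hmonom d}| (hpoly d).
Proof.
exists (fun p : hpoly d => \row_i (val p)@_(val (enum_val i : hmonom d))).
  by move=> c p q; apply/rowP=> i; rewrite !mxE mcoeffD mcoeffZ.
pose mk (r : 'rV[K]_#|{: hmonom d}|) :=
  \sum_(i < #|{: hmonom d}|) r 0 i *: 'X_[val (enum_val i : hmonom d)].
have mkP r : mk r \is d.-homog.
  apply: rpred_sum => i _; apply: rpredZ; rewrite dhomogX.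
  exact: (valP (enum_val i)).
have mkE r (x : hmonom d) : (mk r)@_(val x) = r 0 (enum_rank x).
  rewrite /mk raddf_sum /= (bigD1 (enum_rank x)) //= big1 ?addr0.
    by rewrite mcoeffZ mcoeffX enum_rankK eqxx mulr1.
  move=> i ne; rewrite mcoeffZ mcoeffX (_ : (_ == _) = false) ?mulr0 //.
  apply/negbTE; apply: contraNneq ne => /val_inj/val_inj <-.
  by rewrite enum_valK.
exists (fun r => DHomog (mkP r)) => [p|r].
  apply/val_inj/mpolyP=> m /=; have [dm|dm] := eqVneq (mdeg m) d; last first.
    rewrite !(@dhomog_nemf_coeff _ _ mdeg d) //; first exact: (valP p).
  have ltm : (mdeg m < d.+1)%N by rewrite dm.
  have dm' : mdeg (BMultinom ltm) == d by apply/eqP.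
  by rewrite (mkE _ (Sub (BMultinom ltm) dm' : hmonom d)) mxE enum_rankK.
by apply/rowP=> i; rewrite mxE /= mkE enum_valK.
Qed.

HB.instance Definition _ d :=
  Lmodule_hasFinDim.Build K (hpoly d) (@hpoly_vecaxiom d).

(* The homogeneous component pi_d(H) of the space H of q-harmonics. *)
Definition harm q d : {vspace hpoly d} :=
  vspace_of (fun p : hpoly d =>
    exists2 f, qharmonic q f & val p = pihomog mdeg d f).

Lemma qharmonic_linear q c f g :
  qharmonic q f -> qharmonic q g -> qharmonic q (c *: f + g).
Proof.
move=> hf hg k k_gt0; have Dlin : Dop q k (c *: f + g) =
    c *: Dop q k f + Dop q k g; last by rewrite Dlin hf ?hg // scaler0 addr0.
rewrite /Dop; have -> : Dtilde k (c *: f + g) = c *: Dtilde k f + Dtilde k g.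
  rewrite /Dtilde scaler_sumr -big_split /=; apply: eq_bigr => i _.
  by rewrite linearP /= mulrDr scalerAr.
have -> : nabla k (c *: f + g) = c *: nabla k f + nabla k g.
  rewrite /nabla scaler_sumr -big_split /=; apply: eq_bigr => i _.
  by rewrite linearP.
by rewrite !scalerDr !scalerA [q * c]mulrC addrACA.
Qed.

Lemma harmP q d (p : hpoly d) :
  p \in harm q d <-> exists2 f, qharmonic q f & val p = pihomog mdeg d f.
Proof.
apply: (vspace_ofP (P := fun p : hpoly d => _)) => [|c u v].
  exists 0; last by rewrite pihomog0.
  move=> k _; rewrite /Dop /Dtilde /nabla !big1 ?scaler0 ?addr0 //= => i _.
    by rewrite raddf0.
  by rewrite raddf0 mulr0.
move=> [f hf uE] [g hg vE]; exists (c *: f + g); first exact: qharmonic_linear.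
rewrite [RHS]linearP; exact: (congr2 (fun a b => c *: a + b) uE vE).
Qed.

(* Action of 'S_n on homogeneous polynomials; s sends 'X_i to 'X_(s i). *)
Lemma msym_hpoly d s (p : hpoly d) : msym s (val p) \is d.-homog.
Proof. by rewrite homog_piE -msym_pihomog (pihomog_dE (valP p)). Qed.

Definition hsym d s (p : hpoly d) : hpoly d := DHomog (msym_hpoly s p).

Let perm_eqE s i j : (s i == j) = (i == s^-1%g j).
Proof. by apply/eqP/eqP => [<-|->]; rewrite ?permK ?permKV. Qed.

Lemma msym_mderivn s i k p : msym s p^`M(i, k) = (msym s p)^`M(s i, k).
Proof.
elim/mpolyind: p => [|c m p _ _ IHp]; first by rewrite !raddf0.
rewrite !raddfD /= IHp; congr (_ + _).
rewrite !(mderivmZ, msymZ) [msym s 'X_[m]]msymX !mderivnX msymZ msymX.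
have -> : [multinom m (s^-1%g j) | j < n] (s i) = m i by rewrite mnmE permK.
congr (_ *: (_ *: 'X_[_])); apply/mnmP => j.
by rewrite !mnmE !mulmnE !mnm1E perm_eqE.
Qed.

Lemma qharmonic_msym q s f : qharmonic q f -> qharmonic q (msym s f).
Proof.
move=> hf k k_gt0; have := congr1 (msym s) (hf k k_gt0).
rewrite raddf0 /Dop msymD msymZ => <-; congr (_ *: _ + _);
  rewrite /Dtilde /nabla raddf_sum (reindex_inj (@perm_inj _ s)) /=;
  apply: eq_bigr => i _; last by rewrite msym_mderivn.
rewrite msymM msym_mderivn; congr (_ * _).
rewrite msymX; congr 'X_[_]; apply/mnmP => j.
by rewrite !mnmE perm_eqE.
Qed.

Lemma harm_stable q d s (p : hpoly d) : p \in harm q d -> hsym s p \in harm q d.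
Proof.
move=> /harmP [f hf pE]; apply/harmP; exists (msym s f).
  exact: qharmonic_msym.
by rewrite /= pE msym_pihomog.
Qed.

Definition harm_char q d s : K := trace_on (harm q d) (hsym s).

End Harmonics.

(* A symmetric function, represented by its specializations to finitely many
   variables x_0, ..., x_(N-1), for all N. *)
Definition symfun (K : fieldType) := forall N : nat, {mpoly K[N]}.

Definition power_sum (K : fieldType) (N k : nat) : {mpoly K[N]} :=
  \sum_(i < N) 'X_i ^+ k.

(* Frobenius characteristic of a representation of 'S_n with character chi:
   (1 / n!) \sum_s chi(s) p_(cycle type of s). *)
Definition Frob (K : fieldType) (n : nat) (chi : 'S_n -> K) : symfun K :=
  fun N => (n`!%:R)^-1 *:
    \sum_(s : 'S_n) chi s *: \prod_(c in porbits s) power_sum K N #|c|.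

(* F_{n;q}(t), as the sequence of the coefficients of t^d. *)
Definition Fchar (K : fieldType) (n : nat) (q : K) : nat -> symfun K :=
  fun d => Frob (@harm_char K n q d).

Definition singular (K : fieldType) (n : nat) (q : K) : Prop :=
  Fchar n q <> Fchar n 0.

(* Main.v *)
From HB Require Import structures.
Require Import Defs.
From mathcomp Require Import all_boot all_order all_fingroup all_algebra.
From mathcomp Require Import reals complex mpoly ring zify.

(** Every classical harmonic (q = 0) that is fixed by the stabilizer of a
    variable x_i0 has degree less than n.  So it is enough to exhibit, for
    q = -a/b, a nonzero homogeneous q-harmonic of degree b >= n that is fixed
    by such a stabilizer, and to check that the Frobenius characteristic sees
    the difference.

    All computations use the coefficients c(m) = m_1! ... m_n! [x^m] f
    ([dpcoef]), that is, the coefficients of f on the divided powers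
    x^m / m!.  On these the derivatives act as shifts, and f is q-harmonic iff
    sum_i (q m_i + 1) c(m + k e_i) = 0 for all m and all k >= 1
    ([qharmonicP]).

    - At q = 0, suppose that c is invariant under the stabilizer of i0, and let
      t be one more than the number of nonzero entries of m off i0.  The
      relations give, by induction on t,
      'C(n-1, t-1) c(m) = (-1)^(t-1) c(d e_i0), where d is the degree of m
      ([classical_coef_esupp]).  When d >= n there is one more relation: its
      base point has every entry off i0 equal to 1, all its n terms are equal,
      and it forces c(d e_i0) = 0 ([classical_fixed_eq0]).

    - At q = -a/b and for a set A of a variables with sum s_A, the polynomial
      (a x_i0 - s_A) s_A^(b-1) is q-harmonic whenever i0 belongs to A.  Summing
      over all such A gives a q-harmonic fixed by the stabilizer of i0, with
      coefficients (a m_i0 - b) 'C(n - t, n - a), up to a scalar ([wcoef]).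
      Its coefficient on x_i0^b is nonzero as soon as a >= 2.  When a = 1 the
      same q is written -n/(nb).

    - Evaluating the derivative along x_1 at (1, 0) on the two-variable
      specialization of the characteristic turns each permutation into its
      number of fixed points ([slope_Frob]), that is, pairs the characteristic
      with h_(n-1) h_1.  Hence F determines sum_s chi(s) #fix(s), which is the
      sum over i of the trace of the sum of the stabilizer of i
      ([sum_harm_char]).  That operator is a positive multiple of the
      projection on the vectors fixed by the stabilizer: the sum is zero at
      q = 0 in degree b >= n, and positive at q = -a/b. *)

Set Implicit Arguments.
Unset Strict Implicit.
Unset Printing Implicit Defensive.

Import Order.TTheory GRing.Theory Num.Theory.
Local Open Scope ring_scope.

(** * Harmonicity on divided-power coefficients *)

Section Coefficients.
Context (K : numFieldType) (n : nat).
Implicit Types (p f : {mpoly K[n]}) (q : K) (m : 'X_{1..n}) (i j : 'I_n).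
Implicit Types (c : 'X_{1..n} -> K).

Definition mfact m : nat := \prod_(i < n) (m i)`!.

Lemma mfact_neq0 m : (mfact m)%:R != 0 :> K.
Proof.
by rewrite pnatr_eq0 -lt0n prodn_gt0 // => i; rewrite fact_gt0.
Qed.

Lemma mfactDU m i : mfact (m + U_(i)) = ((m i).+1 * mfact m)%N.
Proof.
rewrite /mfact (bigD1 i) //= [in RHS](bigD1 i) //= mulnA.
rewrite mnmDE mnm1E eqxx addn1 factS; congr (_ * _)%N.
apply: eq_bigr => j ji; rewrite mnmDE mnm1E eq_sym (negbTE ji).
by rewrite addn0.
Qed.

Definition dpcoef p m : K := p@_m * (mfact m)%:R.

Lemma dpcoef_eq0 p : (forall m, dpcoef p m = 0) -> p = 0.
Proof.
move=> p0; apply/mpolyP => m; rewrite mcoeff0.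
by have /eqP := p0 m; rewrite mulf_eq0 (negbTE (mfact_neq0 m)) orbF => /eqP.
Qed.

(** The reason for using divided powers: derivatives shift coefficients. *)
Lemma dpcoef_deriv i k p m :
  dpcoef p^`M(i, k) m = dpcoef p (m + U_(i) *+ k)%MM.
Proof.
elim: k m => [|k IHk] m; first by rewrite mderivn0 mulm0n addm0.
rewrite mderivnS {1}/dpcoef mcoeff_mderiv mulrnAl -mulrnAr -mulrnA mulnC -mfactDU.
by rewrite -/(dpcoef _ _) IHk -addmA mulmS.
Qed.

Lemma dpcoef_euler i p m :
  dpcoef ('X_i * p^`M(i)) m = (m i)%:R * dpcoef p m.
Proof.
rewrite /dpcoef mulrA; congr (_ * _).
elim/mpolyind: p => [|c m' p _ _ IHp]; first by rewrite !raddf0 mulr0 mcoeff0 mulr0.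
rewrite mderivD mulrDr !mcoeffD mulrDr IHp; congr (_ + _).
rewrite mderivZ mderivX -!scalerAr -mpolyXD !mcoeffZ !mcoeffX.
have [m'0|m'0] := eqVneq (m' i) 0%N.
  rewrite m'0 mul0r mulr0; case: eqP => [<-|_]; last by rewrite !mulr0.
  by rewrite m'0 mul0r.
rewrite addmC submK ?lep1mP //.
by case: eqP => [<-|_]; rewrite ?mulr0 // !mulr1 mulrC.
Qed.

Lemma dpcoef_Dop q k p m :
  dpcoef (Dop q k p) m =
    \sum_(i < n) (q * (m i)%:R + 1) * dpcoef p (m + U_(i) *+ k)%MM.
Proof.
have dpD f g : dpcoef (f + g) m = dpcoef f m + dpcoef g m.
  by rewrite /dpcoef mcoeffD mulrDl.
have dpS (F : 'I_n -> {mpoly K[n]}) :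
    dpcoef (\sum_i F i) m = \sum_i dpcoef (F i) m.
  by rewrite /dpcoef raddf_sum mulr_suml.
rewrite /Dop dpD {1}/dpcoef mcoeffZ -mulrA -/(dpcoef _ _) !dpS mulr_sumr.
rewrite -big_split; apply: eq_bigr => i _ /=.
by rewrite mderivnS dpcoef_euler dpcoef_deriv mulrDl mul1r mulrA.
Qed.

Definition dpharmonic q c := forall k m, (0 < k)%N ->
  \sum_(i < n) (q * (m i)%:R + 1) * c (m + U_(i) *+ k)%MM = 0.

Lemma qharmonicP q p : qharmonic q p <-> dpharmonic q (dpcoef p).
Proof.
split=> [hp k m k_gt0 | hp k k_gt0].
  by rewrite -dpcoef_Dop hp // /dpcoef mcoeff0 mul0r.
by apply: dpcoef_eq0 => m; rewrite dpcoef_Dop hp.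
Qed.

Definition perm_mnm m (s : 'S_n) : 'X_{1..n} := [multinom m (s i) | i < n].

Lemma dpcoef_msym s p m : dpcoef (msym s p) m = dpcoef p (perm_mnm m s).
Proof.
rewrite /dpcoef mcoeff_sym; congr (_ * _%:R).
rewrite /mfact (reindex_inj (@perm_inj _ s)) /=.
by apply: eq_bigr => i _; rewrite mnmE.
Qed.

Definition stab_fixed i0 c :=
  forall (s : 'S_n) m, s i0 = i0 -> c (perm_mnm m s) = c m.

Lemma dpcoef_pihomog d p m :
  dpcoef (pihomog mdeg d p) m = if mdeg m == d then dpcoef p m else 0.
Proof.
have -> : (if mdeg m == d then dpcoef p m else 0) =
  (if mdeg m == d then p@_m else 0) * (mfact m)%:R.
  by case: ifP => _ //; rewrite mul0r.
congr (_ * _).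
elim/mpolyind: p => [|c m' p _ _ IHp]; first by rewrite pihomog0 mcoeff0 if_same.
rewrite pihomogD !mcoeffD IHp linearZ /= pihomogX !mcoeffZ.
case: (eqVneq (mdeg m') d) => [<-|ne]; rewrite ?mcoeffX.
  case: (eqVneq m' m) => [->|_]; first by rewrite eqxx.
  by rewrite mulr0 !add0r.
rewrite mcoeff0 mulr0 add0r; case: ifP => [/eqP dm|_] //.
by case: (m' =P m) ne => [->|_]; rewrite ?dm ?eqxx // mulr0 add0r.
Qed.

(** Each relation between the coefficients lives in a single degree. *)
Lemma qharmonic_pihomog q d p :
  qharmonic q p -> qharmonic q (pihomog mdeg d p).
Proof.
move/qharmonicP => hp; apply/qharmonicP => k m k_gt0.
under eq_bigr do rewrite dpcoef_pihomog mdegD mdegMn mdeg1 mul1n.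
by case: (mdeg m + k == d)%N; [exact: hp | rewrite big1 // => i _; rewrite mulr0].
Qed.

(** * Classical harmonics fixed by a point stabilizer *)

(** The support of [m], extended by [i0]: among the exponents of one degree,
    the value of a stabilizer-invariant harmonic will depend on its size only. *)
Definition esupp i0 m : {set 'I_n} := [set i | (i == i0) || (m i != 0%N)].

Lemma esuppDU_in i0 m i k : i \in esupp i0 m ->
  esupp i0 (m + U_(i) *+ k)%MM = esupp i0 m.
Proof.
rewrite inE => im; apply/setP => j; rewrite !inE mnmDE mulmnE mnm1E.
case: (eqVneq i j) => [<-|_]; last by rewrite mul0n addn0.
by case/orP: im => [->//|]; rewrite addn_eq0 negb_and => ->; rewrite orbT.
Qed.

Lemma esuppDU_notin i0 m i k : (0 < k)%N -> i \notin esupp i0 m ->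
  esupp i0 (m + U_(i) *+ k)%MM = i |: esupp i0 m.
Proof.
move=> k_gt0 im; apply/setP => j; rewrite !inE mnmDE mulmnE mnm1E.
rewrite [j == i]eq_sym.
case: (eqVneq i j) => [<-|_]; last by rewrite mul0n addn0.
by rewrite mul1n addn_eq0 negb_and -[k != _]lt0n k_gt0 !orbT.
Qed.

Lemma esupp_le i0 m : (0 < #|esupp i0 m| <= n)%N.
Proof.
apply/andP; split; last by rewrite -[X in (_ <= X)%N]card_ord max_card.
by rewrite card_gt0; apply/set0Pn; exists i0; rewrite inE eqxx.
Qed.

Lemma esupp_perm i0 (s : 'S_n) m : s i0 = i0 ->
  #|esupp i0 (perm_mnm m s)| = #|esupp i0 m|.
Proof.
move=> si0; have -> : esupp i0 (perm_mnm m s) = s @^-1: esupp i0 m.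
  apply/setP => i; rewrite !inE mnmE; congr (_ || _).
  by rewrite -(inj_eq (@perm_inj _ s)) si0.
exact/card_preimset/perm_inj.
Qed.

Lemma stab_fixed_shift i0 c m k i j : stab_fixed i0 c ->
  i \notin esupp i0 m -> j \notin esupp i0 m ->
  c (m + U_(i) *+ k)%MM = c (m + U_(j) *+ k)%MM.
Proof.
move=> cfix; rewrite !inE !negb_or !negbK => /andP[ii0 /eqP mi] /andP[ji0 /eqP mj].
rewrite -(cfix (tperm i j)); last by rewrite tpermD.
congr c; apply/mnmP => l; rewrite mnmE !mnmDE !mulmnE !mnm1E.
case: tpermP => [->|->|/eqP li /eqP lj].
- by rewrite mi mj eq_sym.
- by rewrite mi mj !eqxx.
- by rewrite [i == l]eq_sym [j == l]eq_sym (negbTE li) (negbTE lj).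
Qed.

(** The terms of a harmonicity relation outside the extended support are all
    equal, so that the relation determines their common value from terms of
    smaller support. *)
Lemma sum_esupp i0 c m k i q : stab_fixed i0 c -> i \notin esupp i0 m ->
  \sum_(j < n) (q * (m j)%:R + 1) * c (m + U_(j) *+ k)%MM =
    \sum_(j in esupp i0 m) (q * (m j)%:R + 1) * c (m + U_(j) *+ k)%MM +
    (n - #|esupp i0 m|)%:R * c (m + U_(i) *+ k)%MM.
Proof.
move=> cfix im; rewrite (bigID (mem (esupp i0 m))) /=; congr (_ + _).
transitivity (\sum_(j | j \notin esupp i0 m) c (m + U_(i) *+ k)%MM).
  apply: eq_bigr => j jm; rewrite (stab_fixed_shift _ cfix jm im).
  move: jm; rewrite inE negb_or negbK => /andP[_ /eqP->].
  by rewrite mulr0 add0r mul1r.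
have -> : (n - #|esupp i0 m|)%N = #|~: esupp i0 m|.
  by rewrite [RHS]cardsCs card_ord setCK.
rewrite mulr_natl -sumr_const; apply: eq_bigl => j.
by rewrite in_setC.
Qed.

Lemma mdeg_mnmU i k : mdeg (U_(i) *+ k)%MM = k.
Proof. by rewrite mdegMn mdeg1 mul1n. Qed.

(** Induction on the size t of the extended support.  Zeroing an entry m_j of
    [m], j <> i0, gives the base point of a relation with t - 1 terms of
    support size t - 1, the other n - t + 1 terms being equal to c(m). *)
Lemma classical_coef_esupp i0 c m : stab_fixed i0 c -> dpharmonic 0 c ->
  'C(n.-1, #|esupp i0 m|.-1)%:R * c m =
    (-1) ^+ #|esupp i0 m|.-1 * c (U_(i0) *+ mdeg m)%MM.
Proof.
move=> cfix charm; move E : #|esupp i0 m| => t1.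
have t1_gt0 : (0 < t1)%N by rewrite -E; case/andP: (esupp_le i0 m).
case: t1 t1_gt0 E => // t _ /=; elim: t m => [|t IHt] m E.
  rewrite bin0 expr0 !mul1r; congr c.
  have {}E : esupp i0 m = [set i0].
    apply/esym/eqP; rewrite eqEcard E cards1 andbT sub1set.
    by rewrite inE eqxx.
  have m0 i : i != i0 -> m i = 0%N.
    by move=> ii0; move/setP/(_ i): E; rewrite !inE (negbTE ii0) /= => /eqP.
  apply/mnmP => i; rewrite mulmnE mnm1E mdegE (bigD1 i0) //= big1 ?addn0 //.
  case: eqVneq => [<-|ii0]; first by rewrite mul1n.
  by rewrite m0 // eq_sym.
have [j jm ji0] : exists2 j, j \in esupp i0 m & j != i0.
  have : (0 < #|esupp i0 m :\ i0|)%N.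
    by move: E; rewrite (cardsD1 i0) inE eqxx /= add1n => -[->].
  by case/card_gt0P => j; rewrite in_setD1 => /andP[ji0 jm]; exists j.
pose m' := [multinom if i == j then 0%N else m i | i < n].
have mj : (0 < m j)%N by move: jm; rewrite inE (negbTE ji0) lt0n.
have mE : m = (m' + U_(j) *+ m j)%MM.
  apply/mnmP => i; rewrite mnmDE mulmnE mnm1E mnmE [j == i]eq_sym.
  by case: eqVneq => [->|]; rewrite ?mul1n // addn0.
have jm' : j \notin esupp i0 m' by rewrite inE mnmE eqxx (negbTE ji0).
have E' : #|esupp i0 m'| = t.+1.
  by move: E; rewrite mE esuppDU_notin // cardsU1 jm' => -[].
have := charm (m j) m' mj; rewrite (sum_esupp _ _ cfix jm') -mE E'.
move/(congr1 ( *%R 'C(n.-1, t)%:R)); rewrite mulr0 mulrDr mulr_sumr.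
rewrite (eq_bigr (fun=> (-1) ^+ t * c (U_(i0) *+ mdeg m)%MM)); last first.
  move=> i im'; rewrite mul0r add0r mul1r IHt ?esuppDU_in //.
  by rewrite mdegD mdeg_mnmU [in RHS]mE mdegD mdeg_mnmU.
rewrite sumr_const E' mulrA -natrM.
have -> : ('C(n.-1, t) * (n - t.+1) = t.+1 * 'C(n.-1, t.+1))%N.
  by rewrite mul_bin_left mulnC subnS -subn1 subnAC subn1.
rewrite natrM -mulrA -[X in X + _]mulr_natl -mulrDr => /eqP.
rewrite mulf_eq0 pnatr_eq0 /= addrC addr_eq0 => /eqP ->.
by rewrite exprS mulN1r mulNr.
Qed.

(** In degree at least n there is a relation all of whose terms have full
    extended support; they are all equal by the previous lemma. *)
Lemma classical_fixed_eq0 i0 c m : stab_fixed i0 c -> dpharmonic 0 c ->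
  (n <= mdeg m)%N -> c m = 0.
Proof.
move=> cfix charm dm; have n_gt0 : (0 < n)%N := leq_ltn_trans (leq0n _) (ltn_ord i0).
suff c0 : c (U_(i0) *+ mdeg m)%MM = 0.
  have := classical_coef_esupp m cfix charm; rewrite c0 mulr0 => /eqP.
  rewrite mulf_eq0 pnatr_eq0 => /orP[|/eqP//].
  case/andP: (esupp_le i0 m) => t_gt0 t_le.
  by rewrite -leqn0 leqNgt bin_gt0 -ltnS !prednK // t_le.
pose m1 := [multinom if i == i0 then (mdeg m - n)%N else 1%N | i < n].
have full i : i \in esupp i0 m1 by rewrite inE mnmE; case: eqP.
have fullT : #|esupp i0 m1| = n.
  by rewrite -[RHS]card_ord; apply: eq_card => i; rewrite full.
have dm1 i : mdeg (m1 + U_(i))%MM = mdeg m.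
  rewrite mdegD mdeg1 mdegE (bigD1 i0) //= mnmE eqxx.
  rewrite (eq_bigr (fun=> 1%N)); last by move=> j /negbTE; rewrite mnmE => ->.
  rewrite sum1_card cardC1 card_ord; lia.
have := charm 1%N m1 isT.
rewrite (eq_bigr (fun=> (-1) ^+ n.-1 * c (U_(i0) *+ mdeg m)%MM)); last first.
  move=> i _; rewrite mul0r add0r mul1r mulm1n.
  have := classical_coef_esupp (m1 + U_(i))%MM cfix charm.
  have -> : #|esupp i0 (m1 + U_(i))%MM| = n.
    by rewrite -{1}[U_(i)%MM]mulm1n esuppDU_in.
  by rewrite binn mul1r dm1.
rewrite sumr_const card_ord => /eqP; rewrite mulrn_eq0 (gtn_eqF n_gt0) /=.
by rewrite mulf_eq0 signr_eq0 => /eqP.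
Qed.

(** * An explicit harmonic for q = -a/b *)

(** Up to the factor (b-1)!, the divided-power coefficients of the sum of
    (a x_i0 - s_A) s_A^(b-1) over the sets A of a variables containing x_i0,
    where s_A is the sum of A: on a monomial with exponent m, every A that
    contains the extended support of m contributes (a m_i0 - b), and there are
    'C(n - t, a - t) = 'C(n - t, n - a) of them. *)
Definition wcoef a b i0 m : K :=
  if mdeg m == b then
    (a%:R * (m i0)%:R - b%:R) * 'C(n - #|esupp i0 m|, n - a)%:R
  else 0.

Lemma wcoef_stab_fixed a b i0 : stab_fixed i0 (wcoef a b i0).
Proof.
move=> s m si0; rewrite /wcoef esupp_perm // mdeg_mperm.
by rewrite mnmE si0.
Qed.

Lemma wcoef_bin a t : (a <= n)%N -> (t <= n)%N ->
  (n - t)%:R * 'C((n - t).-1, n - a)%:R =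
  (a%:R - t%:R) * 'C(n - t, n - a)%:R :> K.
Proof.
move=> a_le t_le; rewrite -natrM mul_bin_down.
have [t_gt|t_le_a] := ltnP a t.
  (* here n - t < n - a, so both sides vanish *)
  by rewrite bin_small ?muln0 ?mulr0 //; lia.
by rewrite natrM -natrB //; congr (_%:R * _); lia.
Qed.

(** With u = a m_i0 - b, the terms of the relation add up to u times
    (t - a) 'C(n-t, n-a) + (n - t) 'C(n-t-1, n-a), which is zero by the
    absorption identity for binomials. *)
Lemma wcoef_harmonic a b i0 : (a <= n)%N -> (0 < b)%N ->
  dpharmonic (- (a%:R / b%:R)) (wcoef a b i0).
Proof.
move=> a_le b_gt0 k m k_gt0; rewrite /wcoef.
under eq_bigr do rewrite mdegD mdeg_mnmU.
case: eqP => [bE|_]; last by rewrite big1 // => i _; rewrite mulr0.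
set t := #|esupp i0 m|; set q := - _.
pose u : K := a%:R * (m i0)%:R - b%:R.
pose N : K := 'C(n - t, n - a)%:R; pose N' : K := 'C((n - t).-1, n - a)%:R.
have qb : q * b%:R = - a%:R by rewrite mulNr divfK // pnatr_eq0 -lt0n.
(* only the term i = i0 moves the entry at i0, which turns u into u + a k *)
transitivity (\sum_(i < n)
   ((if i == i0 then (q * (m i0)%:R + 1) * a%:R * k%:R * N else 0)
    + if i \in esupp i0 m then (q * (m i)%:R + 1) * (u * N) else u * N')).
  apply: eq_bigr => i _; case: (boolP (i \in esupp i0 m)) => im.
    rewrite esuppDU_in // mnmDE mulmnE mnm1E natrD natrM -/t -/N.
    by case: eqVneq => [->|_] /=; rewrite /u; ring.
  rewrite esuppDU_notin // cardsU1 im -/t add1n subnS -/N'.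
  move: (im); rewrite inE negb_or negbK => /andP[/negbTE ii0 /eqP->].
  by rewrite mnmDE mulmnE mnm1E ii0 mul0n addn0 /u; ring.
rewrite big_split /= -big_mkcond big_pred1_eq (bigID (mem (esupp i0 m))) /=.
have t_le : (t <= n)%N by case/andP: (esupp_le i0 m).
have -> : \sum_(i | i \in esupp i0 m)
     (if i \in esupp i0 m then (q * (m i)%:R + 1) * (u * N) else u * N') =
     (q * (mdeg m)%:R + t%:R) * (u * N).
  rewrite (eq_bigr (fun i => (q * (m i)%:R + 1) * (u * N))); last by move=> i ->.
  rewrite -mulr_suml big_split sumr_const -/t; congr ((_ + _) * _).
  rewrite -mulr_sumr mdegE natr_sum; congr (_ * _).
  rewrite [RHS](bigID (mem (esupp i0 m))) /= [X in _ = _ + X]big1 ?addr0 //.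
  by move=> i; rewrite inE negb_or negbK => /andP[_ /eqP->].
have -> : \sum_(i | i \notin esupp i0 m)
     (if i \in esupp i0 m then (q * (m i)%:R + 1) * (u * N) else u * N') =
     u * ((n - t)%:R * N').
  rewrite (eq_bigr (fun=> u * N')); last by move=> i /negbTE ->.
  rewrite (eq_bigl (mem (~: esupp i0 m))); last by move=> i; rewrite /= in_setC.
  rewrite sumr_const cardsCs setCK card_ord -/t -mulr_natl; ring.
rewrite wcoef_bin // -/N.
have kE : k%:R = b%:R - (mdeg m)%:R :> K by rewrite -bE natrD addrC addKr.
(* eliminating k = b - |m| and a = - q b leaves a polynomial identity *)
have aE : a%:R = - (q * b%:R) by rewrite qb opprK.
rewrite kE /u aE; ring.
Qed.

Lemma wcoef_neq0 a b i0 : (2 <= a <= n)%N -> (0 < b)%N ->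
  wcoef a b i0 (U_(i0) *+ b)%MM != 0.
Proof.
move=> /andP[a_ge2 a_le] b_gt0; rewrite /wcoef mdeg_mnmU eqxx.
have -> : esupp i0 (U_(i0) *+ b)%MM = [set i0].
  apply/setP => i; rewrite !inE mulmnE mnm1E eq_sym.
  by case: eqVneq; rewrite //= mul0n.
rewrite cards1 mulmnE mnm1E eqxx mul1n mulf_neq0 //.
  by rewrite -natrM -natrB ?pnatr_eq0 -?lt0n; nia.
rewrite pnatr_eq0 -lt0n bin_gt0; lia.
Qed.

Lemma hpoly_of_dpcoef d c : (forall m, mdeg m != d -> c m = 0) ->
  exists p : hpoly K n d, dpcoef (val p) =1 c.
Proof.
move=> c0; pose e m := c m / (mfact m)%:R.
pose p := \sum_(m : 'X_{1..n < d.+1}) e m *: 'X_[m] : {mpoly K[n]}.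
have homp : p \is d.-homog.
  apply: rpred_sum => m _; have [md|md] := eqVneq (mdeg m) d.
    by apply: rpredZ; rewrite dhomogX; apply/eqP.
  by rewrite /e c0 // mul0r scale0r rpred0.
exists (DHomog homp) => m; rewrite /dpcoef /=.
have [md|md] := eqVneq (mdeg m) d; last first.
  by rewrite (dhomog_nemf_coeff homp) // mul0r c0.
by rewrite mcoeff_mpoly ?md // divfK // mfact_neq0.
Qed.

End Coefficients.

(** * Traces of multiples of projections *)

(** If A = C R is a full rank factorization and A^2 = c A, then R C = c 1, whose
    trace is c times the rank. *)
Lemma mxtrace_scaled_idem (F : fieldType) k (A : 'M[F]_k) (c : F) :
  A *m A = c *: A -> \tr A = c * (\rank A)%:R.
Proof.
move=> AA; rewrite -{1}[A]mulmx_base mxtrace_mulC.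
suff -> : row_base A *m col_base A = c%:M by rewrite mxtrace_scalar mulr_natr.
apply: (row_free_inj (row_base_free A)); apply: (row_full_inj (col_base_full A)).
rewrite /= -[row_base A *m _ *m _]mulmxA mulmxA mulmx_base AA mul_scalar_mx.
by rewrite -scalemxAr mulmx_base.
Qed.

Section TraceOn.
Context (F : fieldType) (V : vectType F) (U : {vspace V}).

Lemma trace_on_sum (I : finType) (P : pred I) (f : I -> V -> V) :
  trace_on U (fun v => \sum_(s | P s) f s v) = \sum_(s | P s) trace_on U (f s).
Proof.
by rewrite exchange_big; apply: eq_bigr => i _; rewrite linear_sum.
Qed.

Lemma trace_on_eq0 (f : V -> V) : {in U, f =1 fun=> 0} -> trace_on U f = 0.
Proof.
move=> f0; rewrite /trace_on big1 // => i _.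
by rewrite f0 ?linear0 // vbasis_mem // mem_nth // size_tuple.
Qed.

Lemma trace_on_scaled_idem (f : {linear V -> V}) (c : F) (v : V) :
    {in U, forall u, f u \in U} -> {in U, forall u, f (f u) = c *: f u} ->
    v \in U -> f v != 0 ->
  exists2 r, (0 < r)%N & trace_on U f = c * r%:R.
Proof.
move=> fU ff vU fv.
pose A := \matrix_(i, j < \dim U) coord (vbasis U) j (f (vbasis U)`_i).
have bU (i : 'I_(\dim U)) : (vbasis U)`_i \in U.
  by rewrite vbasis_mem // mem_nth // size_tuple.
have fE u : u \in U -> f u = \sum_i coord (vbasis U) i u *: f (vbasis U)`_i.
  move=> uU; rewrite {1}(coord_vbasis uU) linear_sum.
  by apply: eq_bigr => i _; rewrite linearZ.
have trA : trace_on U f = \tr A by apply: eq_bigr => i _; rewrite mxE.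
exists (\rank A); last first.
  rewrite trA (mxtrace_scaled_idem (c := c)) //; apply/matrixP => i l; rewrite !mxE.
  transitivity (coord (vbasis U) l (f (f (vbasis U)`_i))); last first.
    by rewrite ff // linearZ.
  rewrite [f (f _)]fE ?fU // linear_sum.
  by apply: eq_bigr => j _; rewrite !mxE linearZ.
rewrite lt0n mxrank_eq0; apply: contra fv => /eqP A0.
rewrite fE // big1 // => i _; rewrite (coord_vbasis (fU _ (bU i))).
rewrite big1 ?scaler0 // => j _.
by have := congr1 (fun M : 'M_(_, _) => M i j) A0; rewrite !mxE => ->; rewrite scale0r.
Qed.

End TraceOn.

(** * Averaging over a point stabilizer *)

Section Average.
Context (K : numFieldType) (n d : nat).
Implicit Types (q : K) (i : 'I_n) (p : hpoly K n d) (s t : 'S_n).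

Lemma hsym_linear s : linear (@hsym K n d s).
Proof. by move=> c p p'; apply/val_inj; rewrite /= linearP. Qed.

Lemma hsymM s t p : hsym (s * t)%g p = hsym t (hsym s p).
Proof. by apply/val_inj; rewrite /= msymMm. Qed.

Definition havg i p : hpoly K n d := \sum_(s : 'S_n | s i == i) hsym s p.

Lemma havg_linear i : linear (havg i).
Proof.
move=> c p p'; rewrite scaler_sumr -big_split.
by apply: eq_bigr => s _; exact: hsym_linear.
Qed.

HB.instance Definition _ i := GRing.isLinear.Build K _ _ _ (havg i) (havg_linear i).

Lemma hsym_havg i t p : t i = i -> hsym t (havg i p) = havg i p.
Proof.
move=> ti; pose T := GRing.isLinear.Build K _ _ _ _ (hsym_linear t).
pose L : {linear hpoly K n d -> hpoly K n d} := HB.pack (@hsym K n d t) T.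
rewrite -[hsym t _]/(L _) linear_sum [RHS](reindex_inj (mulIg t)) /=.
apply: eq_big => [s|s _]; last by rewrite hsymM.
by rewrite permM -[X in _ = (_ == X)]ti (inj_eq perm_inj).
Qed.

Definition nstab i : nat := #|[set s : 'S_n | s i == i]|.

Lemma nstab_gt0 i : (0 < nstab i)%N.
Proof. by apply/card_gt0P; exists 1%g; rewrite inE perm1. Qed.

Lemma havg_fixed i p : (forall t, t i = i -> hsym t p = p) ->
  havg i p = (nstab i)%:R *: p.
Proof.
move=> pfix; rewrite /havg (eq_bigr (fun=> p)); last by move=> s /eqP /pfix.
rewrite sumr_const scaler_nat; congr (_ *+ _).
by apply: eq_card => s; rewrite inE.
Qed.

Lemma havg_harm q i p : p \in harm n q d -> havg i p \in harm n q d.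
Proof. by move=> ph; apply: rpred_sum => s _; exact: harm_stable. Qed.

Lemma stab_fixed_hsym i p :
  (forall t, t i = i -> hsym t p = p) <-> stab_fixed i (dpcoef (val p)).
Proof.
split=> [pfix t m ti | pfix t ti]; first by rewrite -dpcoef_msym -{2}(pfix t ti).
apply/val_inj/eqP; rewrite -subr_eq0; apply/eqP/dpcoef_eq0 => m.
rewrite /dpcoef mcoeffB mulrBl -!/(dpcoef _ _) dpcoef_msym pfix //.
by rewrite subrr.
Qed.

Lemma harm_qharmonic q p : p \in harm n q d -> qharmonic q (val p).
Proof. by move=> /harmP[f fh ->]; exact: qharmonic_pihomog. Qed.

Lemma trace_havg0 i : (n <= d)%N -> trace_on (harm n (0 : K) d) (havg i) = 0.
Proof.
move=> nd; apply: trace_on_eq0 => p ph.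
apply/val_inj/dpcoef_eq0 => m /=.
have [md|md] := eqVneq (mdeg m) d; last first.
  by rewrite /dpcoef (dhomog_nemf_coeff (valP (havg i p))) ?mul0r.
apply: (@classical_fixed_eq0 _ _ i); last by rewrite md.
  by apply/stab_fixed_hsym => t; exact: hsym_havg.
exact/qharmonicP/harm_qharmonic/havg_harm.
Qed.

Lemma trace_havg_gt0 q i p :
    p \in harm n q d -> stab_fixed i (dpcoef (val p)) -> p != 0 ->
  0 < trace_on (harm n q d) (havg i).
Proof.
move=> ph /stab_fixed_hsym pfix p0.
have c0 : (nstab i)%:R != 0 :> K by rewrite pnatr_eq0 -lt0n nstab_gt0.
have [||||r r_gt0 ->] := @trace_on_scaled_idem _ _ (harm n q d) (havg i) (nstab i)%:R p.
- by move=> u; exact: havg_harm.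
- by move=> u _; apply: havg_fixed => t; exact: hsym_havg.
- by [].
- by rewrite /= havg_fixed // scaler_eq0 negb_or c0.
by rewrite -natrM ltr0n muln_gt0 nstab_gt0.
Qed.

Definition nfix s : nat := #|[set i | s i == i]|.

(** Exchanging the sum over s with the sum over the fixed points of s. *)
Lemma sum_harm_char q :
  \sum_(s : 'S_n) harm_char q d s * (nfix s)%:R = \sum_i trace_on (harm n q d) (havg i).
Proof.
under [RHS]eq_bigr do rewrite trace_on_sum big_mkcond.
rewrite exchange_big; apply: eq_bigr => s _.
rewrite -big_mkcond sumr_const mulr_natr; congr (_ *+ _).
by apply: eq_card => i; rewrite inE.
Qed.
End Average.

(** * Counting fixed points with the Frobenius characteristic *)

Section Frobenius.
Context (K : numFieldType) (n : nat).
Implicit Types (s : 'S_n) (chi : 'S_n -> K) (f : {mpoly K[2]}).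

Let e0 (i : 'I_2) : K := (i == ord0)%:R.
(** On a homogeneous f of degree n >= 2 this is the coefficient of
    x_0^(n-1) x_1; as a derivative, it is easy to compute on products. *)
Definition slope f : K := (f^`M(ord_max)).@[e0].

Lemma slope_power_sum k : (0 < k)%N ->
  (power_sum K 2%N k).@[e0] = 1 /\ slope (power_sum K 2%N k) = (k == 1)%:R.
Proof.
move=> k_gt0; rewrite /slope /power_sum big_ord_recl big_ord1.
have lift01 : lift ord0 ord0 = ord_max :> 'I_2 by exact/val_inj.
rewrite lift01 !mpolyXn mderivD !mevalD !mderivX !mevalZ !mevalX !big_ord_recl.
rewrite !big_ord0 lift01 !mnmBE !mulmnE !mnm1E /e0 /= !mul0n !mul1n.
rewrite !expr1n !expr0n !mulr1 !mul1r add0r subn1 eqn0Ngt k_gt0 addr0.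
split=> //; case: k k_gt0 => // -[|k] _ /=; first by rewrite mulr1.
by rewrite mulr0.
Qed.

Lemma card_porbit_eq1 s i : (#|porbit s i| == 1%N) = (s i == i).
Proof.
apply/eqP/eqP => [E|E].
  by have := iter_porbit s i; rewrite E.
have -> : porbit s i = [set i]; last exact: cards1.
apply/setP => j; rewrite inE; apply/porbitP/eqP => [[k ->]|->].
  by rewrite permX; elim: k => //= k ->.
by exists 0%N; rewrite perm1.
Qed.

Lemma sum_porbits_eq1 s : (\sum_(c in porbits s) (#|c| == 1) = nfix s)%N.
Proof.
rewrite -big_mkcondr /= sum1dep_card.
have <- : porbit s @: [set i | s i == i] = [set c | c \in porbits s & #|c| == 1%N].
  apply/setP => c; rewrite inE; apply/imsetP/andP; last case => /imsetP[i _ ->].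
    case=> i; rewrite inE -card_porbit_eq1 => ? ->; split=> //.
    exact: imset_f.
  by rewrite card_porbit_eq1 => si; exists i; rewrite ?inE.
apply: card_in_imset => i j; rewrite !inE => /eqP si /eqP sj /eqP.
rewrite eq_porbit_mem => /porbitP[k ->].
by rewrite permX; elim: k => //= k ->.
Qed.

Lemma slopeM f g : slope (f * g) = slope f * g.@[e0] + f.@[e0] * slope g.
Proof. by rewrite /slope mderivM mevalD !mevalM. Qed.

(** By the Leibniz rule, each cycle contributes the slope of its power sum,
    which is 1 for a cycle of length one and 0 otherwise. *)
Lemma slope_cycle s :
  slope (\prod_(c in porbits s) power_sum K 2%N #|c|) = (nfix s)%:R.
Proof.
rewrite -sum_porbits_eq1 natr_sum.
pose G (f : {mpoly K[2]}) (x : K) := f.@[e0] = 1 /\ slope f = x.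
suff [] : G (\prod_(c in porbits s) power_sum K 2%N #|c|)
            (\sum_(c in porbits s) (#|c| == 1%N)%:R) by [].
apply: (big_rec2 G) => [|c f x /imsetP[i _ ->] [f1 fx]].
  by split; rewrite ?meval1 // /slope -mpolyC1 mderivC meval0.
have [|p1 px] := @slope_power_sum #|porbit s i|.
  by rewrite lt0n card_porbit_neq0.
by split; [rewrite mevalM p1 f1 mulr1 | rewrite slopeM p1 px f1 fx mulr1 mul1r].
Qed.

Lemma slope_is_linear : linear_for *%R slope.
Proof. by move=> c f g; rewrite /slope linearP mevalD mevalZ. Qed.

HB.instance Definition _ :=
  GRing.isLinear.Build K {mpoly K[2]} K *%R slope slope_is_linear.

Lemma slope_Frob chi :
  slope (Frob chi 2%N) = (n`!%:R)^-1 * \sum_s chi s * (nfix s)%:R.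
Proof.
rewrite /Frob linearZ linear_sum; congr (_ * _).
by apply: eq_bigr => s _ /=; rewrite linearZ /= slope_cycle.
Qed.

End Frobenius.

(** * Singular values *)

Lemma singular_ge2 (K : numFieldType) (n a b : nat) :
  (2 <= a <= n)%N -> (n <= b)%N -> singular n (- (a%:R / b%:R) : K).
Proof.
move=> a_range b_ge; set q := - _ => Feq.
have n_gt0 : (0 < n)%N by lia.
have b_gt0 : (0 < b)%N by lia.
have a_le : (a <= n)%N by case/andP: a_range.
have := congr1 (fun F => slope (F b 2%N)) Feq; rewrite /Fchar !slope_Frob.
have f0 : (n`!%:R)^-1 != 0 :> K by rewrite invr_eq0 pnatr_eq0 -lt0n fact_gt0.
move/(mulfI f0); rewrite !sum_harm_char [RHS]big1 => [|i _]; last exact: trace_havg0.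
apply/eqP; rewrite gt_eqF //.
have pos i : 0 < trace_on (harm n q b) (@havg K n b i).
  have [p pE] : exists p : hpoly K n b, dpcoef (val p) =1 wcoef K a b i.
    by apply: hpoly_of_dpcoef => m /negbTE mb; rewrite /wcoef mb.
  apply: (trace_havg_gt0 (p := p)).
  - apply/harmP; exists (val p); last by rewrite (pihomog_dE (valP p)).
    apply/qharmonicP => k m k_gt0; under eq_bigr do rewrite pE.
    exact: wcoef_harmonic.
  - by move=> s m si; rewrite !pE; exact: wcoef_stab_fixed.
  - apply: contraNneq (wcoef_neq0 K i a_range b_gt0) => p0.
    by rewrite -pE p0 /dpcoef mcoeff0 mul0r.
pose i0 := Ordinal n_gt0.
rewrite (bigD1 i0) //= ltr_wpDr // sumr_ge0 // => i _; exact: ltW.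
Qed.

Theorem theorem6p1 (R : realType) (n a b : nat)
  (n_ge2 : (2 <= n)%N) (a_range : (1 <= a <= n)%N) (b_ge_n : (n <= b)%N) :
  singular n (- (a%:R / b%:R) : R[i]).
Proof.
case: (ltnP 1 a) => [a_gt1|a_le1].
  by apply: singular_ge2; rewrite // a_gt1; case/andP: a_range.
(* the explicit harmonic vanishes for a = 1; write 1/b as n/(nb) instead *)
have -> : a = 1%N by lia.
have -> : (1%:R / b%:R : R[i]) = n%:R / (n * b)%:R.
  rewrite natrM invfM mulrA divff // pnatr_eq0; lia.
apply: singular_ge2; first lia.
nia.
Qed.
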